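(* Let $X$ be a directed graph (regarded as an abstract simplicial complex) with flow rate $R$, let $\mathcal{C}$ be the concentration sheaf on $X$ with flow rate $R$, let $m:\mathcal{C}\to\mathcal{M}$ be a sampling morphism to a sheaf $\mathcal{M}$ on $X$, and let $\mathcal{A}$ be the ambiguity sheaf of $m$. If $\mathcal{A}$ has no nontrivial global sections, i.e. $\Gamma\mathcal{A}=0$, then the set of measurements completely specifies all concentrations in the network, i.e. the induced linear map on global sections $m_*:\Gamma\mathcal{C}\to\Gamma\mathcal{M}$ is one-to-one.
   Context: **Abstract simplicial complex.** An abstract simplicial complex $X$ over a set $A$ is a collection of subsets of $A$ closed under passing to subsets; its elements are called faces. Faces with one element are vertices, and faces with two elements are edges. Write $a\rightsquigarrow b$ when the face $a$ is a proper subset of the face $b$. A graph gives an abstract simplicial complex whose faces are its vertices and its edges, where an edge is a two-element set of vertices. The empty set is not counted as a face. In a directed graph each edge is in addition given a direction, so it is outgoing from one of its two vertices and incoming to the other. **Sheaf.** A sheaf $\mathcal{F}$ on $X$ assigns a real vector space $\mathcal{F}(a)$ (the stalk at $a$) to each face $a$, and a linear map $\mathcal{F}(a\rightsquigarrow b):\mathcal{F}(a)\to\mathcal{F}(b)$ (the restriction) to each inclusion $a\rightsquigarrow b$, such that $\mathcal{F}(b\rightsquigarrow c)\circ\mathcal{F}(a\rightsquigarrow b)=\mathcal{F}(a\rightsquigarrow c)$ whenever $a\rightsquigarrow b\rightsquigarrow c$. **Global sections.** A global section $s$ of $\mathcal{F}$ assigns $s(a)\in\mathcal{F}(a)$ to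 each face $a$ of $X$ so that $\mathcal{F}(a\rightsquigarrow b)s(a)=s(b)$ for every inclusion $a\rightsquigarrow b$. The vector space of global sections is $\Gamma\mathcal{F}$. **Sheaf morphism.** A sheaf morphism $f:\mathcal{F}\to\mathcal{G}$ assigns a linear map $f_a:\mathcal{F}(a)\to\mathcal{G}(a)$ to each face $a$ such that $f_b\circ\mathcal{F}(a\rightsquigarrow b)=\mathcal{G}(a\rightsquigarrow b)\circ f_a$ for every inclusion $a\rightsquigarrow b$. It induces the linear map $f_*:\Gamma\mathcal{F}\to\Gamma\mathcal{G}$, $(f_*s)(a)=f_a(s(a))$. **Flow rate.** A flow rate $R$ is a real-valued function on the edges of $X$ satisfying the conservation law that at each vertex (having both incoming and outgoing edges) the total flow rate in equals the total flow rate out. In-degrees are finite, and at each vertex with both incoming and outgoing edges the total incoming flow rate is nonzero. **Concentration sheaf.** The concentration sheaf $\mathcal{C}$ on $X$ with flow rate $R$ has stalks $\mathcal{C}(v)=\mathbb{R}^n$ at each vertex $v$ of in-degree $n\ge 1$, and $\mathcal{C}(e)=\mathbb{R}$ at each edge $e$. If $e_1^+,\dots,e_n^+$ are the incoming edges at $v$, the restriction from $v$ to $e_i^+$ is the projection $\mathrm{pr}_i$ onto the $i$-th component. The restriction from $v$ to any outgoing edge $e^-$ is $$\left(\mathcal{C}(v\rightsquigarrow e^-)\right)(c_1,\dots,c_n)=\frac{\sum_{j=1}^n c_j R(e_j^+)}{\sum_{j=1}^n R(e_j^+)}.$$ At a source vertex (in-degree $0$) the stalk is $\mathbb{R}$ and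 the restriction to each outgoing edge is the identity. **Sampling morphism.** A sampling morphism of $\mathcal{C}$ is a sheaf morphism $m:\mathcal{C}\to\mathcal{M}$ to a sheaf $\mathcal{M}$ on $X$ which is the zero map on each edge and is surjective on the stalks over edges. **Ambiguity sheaf.** The ambiguity sheaf $\mathcal{A}$ of $m$ is the sheaf on $X$ with stalks $\mathcal{A}(a)=\ker m_a\subseteq\mathcal{C}(a)$, whose restrictions are those of $\mathcal{C}$ restricted to the stalks of $\mathcal{A}$. *)

(* Defs.v *)
From HB Require Import structures.
From mathcomp Require Import all_boot all_order all_algebra finmap.
From mathcomp Require Import mathcomp_extra boolp classical_sets functions.
From mathcomp Require Import cardinality reals topology normedtype.
From mathcomp.analysis.showcase Require Import summability.

Set Implicit Arguments.
Unset Strict Implicit.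
Unset Printing Implicit Defensive.

Import Order.TTheory GRing.Theory Num.Theory.
Import numFieldNormedType.Exports.
Local Open Scope classical_set_scope.
Local Open Scope ring_scope.

(* The empty set is not counted as a face. *)
Record simplicial_complex (A : Type) := SimplicialComplex {
  faces : set (set A);
  faces_neq0 : forall a, faces a -> a !=set0;
  faces_sub : forall a b, faces b -> a `<=` b -> a !=set0 -> faces a }.

Definition face (A : Type) (X : simplicial_complex A) := {a : set A | faces X a}.

Definition incl (A : Type) (X : simplicial_complex A) (a b : face X) : Prop :=
  sval a `<` sval b.

Notation "a ~> b" := (incl a b) (at level 70, no associativity).

Definition is_edge (A : Type) (X : simplicial_complex A) (a : face X) : Prop :=
  exists u v : A, u <> v /\ sval a = [set u; v].

Record sheaf (R : realType) (A : Type) (X : simplicial_complex A) := Sheaf {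
  stalk :> face X -> lmodType R;
  restr : forall a b : face X, a ~> b -> {linear stalk a -> stalk b};
  restr_comp : forall (a b c : face X) (ab : a ~> b) (bc : b ~> c) (ac : a ~> c),
    restr bc \o restr ab =1 restr ac }.

Arguments restr {R A X} s {a b}.

Record sheaf_morphism (R : realType) (A : Type) (X : simplicial_complex A)
    (F G : sheaf R X) := SheafMorphism {
  component :> forall a : face X, {linear F a -> G a};
  component_natural : forall (a b : face X) (ab : a ~> b),
    component b \o restr F ab =1 restr G ab \o component a }.

Section GlobalSections.
Variables (R : realType) (A : Type) (X : simplicial_complex A).

Definition is_section (F : sheaf R X) (s : forall a : face X, F a) : Prop :=
  forall (a b : face X) (ab : a ~> b), restr F ab (s a) = s b.

Record global_section (F : sheaf R X) := GlobalSection {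
  section_val :> forall a : face X, F a;
  section_compat : is_section section_val }.

Lemma global_section_ext (F : sheaf R X) (s t : global_section F) :
  (forall a, s a = t a) -> s = t.
Proof.
case: s t => [s hs] [t ht] /= st.
have e : s = t by apply: functional_extensionality_dep.
by case: _ / e ht => ht; congr GlobalSection; exact: Prop_irrelevance.
Qed.

HB.instance Definition _ (F : sheaf R X) := gen_eqMixin (global_section F).
HB.instance Definition _ (F : sheaf R X) := gen_choiceMixin (global_section F).

Variable F : sheaf R X.
Implicit Types s t : global_section F.

Fact zero_section_compat : is_section (fun a => 0 : F a).
Proof. by move=> a b ab; rewrite linear0. Qed.
Definition zero_section := GlobalSection zero_section_compat.

Fact opp_section_compat s : is_section (fun a => - s a).
Proof. by move=> a b ab; rewrite linearN section_compat. Qed.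
Definition opp_section s := GlobalSection (opp_section_compat s).

Fact add_section_compat s t : is_section (fun a => s a + t a).
Proof. by move=> a b ab; rewrite linearD !section_compat. Qed.
Definition add_section s t := GlobalSection (add_section_compat s t).

Fact scale_section_compat k s : is_section (fun a => k *: s a).
Proof. by move=> a b ab; rewrite linearZ section_compat. Qed.
Definition scale_section k s := GlobalSection (scale_section_compat k s).

Fact add_sectionA : associative add_section.
Proof. by move=> s t u; apply: global_section_ext => a /=; rewrite addrA. Qed.
Fact add_sectionC : commutative add_section.
Proof. by move=> s t; apply: global_section_ext => a /=; rewrite addrC. Qed.
Fact add_0section : left_id zero_section add_section.
Proof. by move=> s; apply: global_section_ext => a /=; rewrite add0r. Qed.
Fact add_Nsection : left_inverse zero_section opp_section add_section.
Proof. by move=> s; apply: global_section_ext => a /=; rewrite addNr. Qed.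

HB.instance Definition _ := GRing.isZmodule.Build (global_section F)
  add_sectionA add_sectionC add_0section add_Nsection.

Fact scale_sectionA k l s :
  scale_section k (scale_section l s) = scale_section (k * l) s.
Proof. by apply: global_section_ext => a /=; rewrite scalerA. Qed.
Fact scale_1section : left_id 1 scale_section.
Proof. by move=> s; apply: global_section_ext => a /=; rewrite scale1r. Qed.
Fact scale_sectionDr : right_distributive scale_section +%R.
Proof. by move=> k s t; apply: global_section_ext => a /=; rewrite scalerDr. Qed.
Fact scale_sectionDl s : {morph scale_section^~ s : k l / k + l}.
Proof. by move=> k l; apply: global_section_ext => a /=; rewrite scalerDl. Qed.

HB.instance Definition _ := GRing.Zmodule_isLmodule.Build R (global_section F)
  scale_sectionA scale_1section scale_sectionDr scale_sectionDl.

End GlobalSections.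

Section InducedMap.
Variables (R : realType) (A : Type) (X : simplicial_complex A).
Variables (F G : sheaf R X) (f : sheaf_morphism F G).

Fact induced_compat (s : global_section F) : is_section (fun a => f a (s a)).
Proof.
move=> a b ab.
by rewrite -(section_compat s ab); exact/esym/component_natural.
Qed.

Definition induced (s : global_section F) : global_section G :=
  GlobalSection (induced_compat s).

Fact induced_linear : linear induced.
Proof. by move=> k s t; apply: global_section_ext => a /=; rewrite linearP. Qed.

HB.instance Definition _ :=
  GRing.isLinear.Build R (global_section F) (global_section G) *:%R induced
    induced_linear.

End InducedMap.

Section Kernel.
Variables (R : realType) (U V : lmodType R) (f : {linear U -> V}).

Definition ker : pred U := [pred x | f x == 0].

Fact ker_submod_closed : submod_closed ker.
Proof.
split=> [|k x y]; rewrite !inE ?linear0// => /eqP fx /eqP fy.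
by rewrite linearP fx fy scaler0 addr0.
Qed.

HB.instance Definition _ := GRing.isSubmodClosed.Build R U ker ker_submod_closed.

Definition kernel := {x : U | x \in ker}.

HB.instance Definition _ := [isSub of kernel for @sval U (fun x => x \in ker)].
HB.instance Definition _ := [Choice of kernel by <:].
HB.instance Definition _ := [SubChoice_isSubLmodule of kernel by <:].

End Kernel.

Section Ambiguity.
Variables (R : realType) (A : Type) (X : simplicial_complex A).
Variables (F G : sheaf R X) (m : sheaf_morphism F G).

Section Restriction.
Variables (a b : face X) (ab : a ~> b).

Fact restr_in_ker (x : kernel (m a)) : restr F ab (val x) \in ker (m b).
Proof.
rewrite inE; have /= -> := component_natural m ab (val x).
by have := valP x; rewrite inE => /eqP ->; rewrite linear0.
Qed.

Definition ambiguity_restr (x : kernel (m a)) : kernel (m b) :=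
  exist _ (restr F ab (val x)) (restr_in_ker x).

Fact ambiguity_restr_linear : linear ambiguity_restr.
Proof. by move=> k x y; apply: val_inj; rewrite /= !linearP. Qed.

HB.instance Definition _ :=
  GRing.isLinear.Build R (kernel (m a)) (kernel (m b)) *:%R ambiguity_restr
    ambiguity_restr_linear.

End Restriction.

Fact ambiguity_restr_comp (a b c : face X)
    (ab : a ~> b) (bc : b ~> c) (ac : a ~> c) :
  ambiguity_restr bc \o ambiguity_restr ab =1 ambiguity_restr ac.
Proof. by move=> x; apply: val_inj; exact: (restr_comp ab bc ac (val x)). Qed.

Definition ambiguity : sheaf R X :=
  @Sheaf R A X (fun a => kernel (m a)) (fun a b ab => ambiguity_restr ab)
    ambiguity_restr_comp.

End Ambiguity.

(* [arc u v] is an edge directed from [u] to [v].  As an edge is a two-element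
   set with one direction, there are neither loops nor antiparallel arcs. *)
Record digraph := Digraph {
  vertex :> choiceType;
  arc : rel vertex;
  arc_asym : forall u v, arc u v -> ~~ arc v u;
  in_degree_finite : forall v, finite_set [set u | arc u v] }.

Definition edge (D : digraph) : choiceType := {e : D * D | arc e.1 e.2}.
Definition source (D : digraph) (e : edge D) : D := (val e).1.
Definition target (D : digraph) (e : edge D) : D := (val e).2.

Section Digraph.
Variable D : digraph.

Lemma edge_neq (e : edge D) : source e <> target e.
Proof.
case: e => [[u v] /= uv]; rewrite /source /target /= => e.
by have := arc_asym uv; rewrite -e; move: uv; rewrite /= -e => ->.
Qed.

Definition cell (x : D + edge D) : set D :=
  match x with
  | inl v => [set v]
  | inr e => [set source e; target e]
  end.

Fact cell_neq0 a : range cell a -> a !=set0.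
Proof. by move=> [[v|e] _ <-]; [exists v | exists (source e); left]. Qed.

Fact cell_sub a b : range cell b -> a `<=` b -> a !=set0 -> range cell a.
Proof.
move=> [[v|e] _ <-] /= ab [x ax].
  exists (inl v) => //=; apply/seteqP; split=> [_ ->|y /ab ->//].
  by rewrite -(ab _ ax).
have [as_|nas] := pselect (a (source e)); have [at_|nat] := pselect (a (target e)).
- exists (inr e) => //=; apply/seteqP; split=> [_ [->|->]//|].
  exact: ab.
- exists (inl (source e)) => //=; apply/seteqP; split=> [_ ->//|y ay].
  by case: (ab y ay) => // ye; move: ay; rewrite ye.
- exists (inl (target e)) => //=; apply/seteqP; split=> [_ ->//|y ay].
  by case: (ab y ay) => // ye; move: ay; rewrite ye.
- by case: (ab x ax) => xe; move: ax; rewrite xe.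
Qed.

Definition graph_complex : simplicial_complex D :=
  SimplicialComplex cell_neq0 cell_sub.

Fact face_cell (a : face graph_complex) : exists x, cell x = sval a.
Proof. by case: (svalP a) => x _ ax; exists x. Qed.

Definition cell_of (a : face graph_complex) : D + edge D :=
  projT1 (cid (face_cell a)).

Lemma cell_ofK a : cell (cell_of a) = sval a.
Proof. exact: projT2 (cid (face_cell a)). Qed.

Lemma no_incl_chain (a b c : face graph_complex) : a ~> b -> b ~> c -> False.
Proof.
move=> [ab nab] [bc nbc]; have [x ax] := faces_neq0 (svalP a).
move: nab nbc (ab x ax) bc; rewrite -(cell_ofK b) -(cell_ofK c) => nab nbc.
case: (cell_of b) nab nbc => [v|e] /= nab nbc bx bc.
  by apply: nab => _ ->; rewrite -bx.
have ne := @edge_neq e; case: (cell_of c) nbc bc => [w|e'] /= nbc bc.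
  have sw : source e = w by apply: bc; left.
  have tw : target e = w by apply: bc; right.
  by apply: ne; rewrite sw tw.
have sc := bc _ (or_introl erefl); have tc := bc _ (or_intror erefl).
apply: nbc => y /=; case: sc => sc; case: tc => tc; rewrite -?sc -?tc.
- by case: ne; rewrite sc tc.
- by [].
- by case=> ->; [right|left].
- by case: ne; rewrite sc tc.
Qed.

Lemma incl_incident (a b : face graph_complex) : a ~> b ->
  exists v e, [/\ cell_of a = inl v, cell_of b = inr e
                & v = source e \/ v = target e].
Proof.
move=> ab; case E: (cell_of b) => [w|e].
  have [x ax] := faces_neq0 (svalP a).
  have [ab1 []] := ab; move: ab1; rewrite -(cell_ofK b) E /= => ab1 _ ->.
  by rewrite -(ab1 _ ax).
case F: (cell_of a) => [v|e'].
  exists v, e; split=> //; have [ab1 _] := ab.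
  by move: ab1; rewrite -!cell_ofK E F /=; apply.
exfalso; pose c : face graph_complex :=
  exist _ [set source e'] (ex_intro2 _ _ (inl (source e')) I erefl).
apply: (@no_incl_chain c a b) => //; split; rewrite -(cell_ofK a) F /=.
  by move=> _ ->; left.
by move=> /(_ (target e') (or_intror erefl)) h; exact: (@edge_neq e').
Qed.

Lemma finite_in_edges v : finite_set [set e : edge D | target e = v].
Proof.
rewrite (_ : [set _ | _] =
    val @^-1` [set (u, v) | u in [set u | arc u v]]).
  apply: finite_preimage; first by move=> ? ? _ _; exact: val_inj.
  exact/finite_image/in_degree_finite.
apply/seteqP; split=> [[[u w] /= uw]|[[u w] /= uw]]; rewrite /target /=.
  by move=> wv; exists u; rewrite -wv.
by move=> [? _ [_ ->]].
Qed.

Definition in_edges v : {fset edge D} := fset_set [set e | target e = v].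

Lemma mem_in_edges v e : (e \in in_edges v) = (target e == v).
Proof.
rewrite in_fset_set; last exact: finite_in_edges.
by apply/idP/eqP; rewrite inE.
Qed.

Definition in_degree v : nat := #|{: in_edges v}|.

Definition in_edge v (i : 'I_(in_degree v)) : edge D := val (enum_val i).

Definition in_index v e (h : e \in in_edges v) : 'I_(in_degree v) :=
  enum_rank [` h]%fset.

Lemma in_indexK v e (h : e \in in_edges v) : in_edge (in_index h) = e.
Proof. by rewrite /in_edge enum_rankK. Qed.

Definition out_edge v : choiceType := {e : edge D | source e == v}.

End Digraph.

(* Out-degrees may be infinite: the total outgoing flow rate is the
   unconditional sum over the outgoing edges, i.e. the limit of the partial
   sums along the finite sets of outgoing edges. *)
Record flow_rate (R : realType) (D : digraph) := FlowRate {
  rate :> edge D -> R;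
  rate_conserved : forall v : D,
    (exists e : edge D, target e = v) -> (exists e : edge D, source e = v) ->
    partial_sum (fun e : out_edge v => rate (val e)) @ totally
      --> \sum_(e <- in_edges v) rate e;
  rate_in_neq0 : forall v : D,
    (exists e : edge D, target e = v) -> (exists e : edge D, source e = v) ->
    \sum_(e <- in_edges v) rate e != 0 }.

Section VertexRestrictions.
Variable R : realType.

(* The stalk at a vertex of in-degree [n]; at a source vertex ([n = 0]) it is
   the real line rather than the zero space, and [outgoing_restr] below is then
   the identity.  [incoming_restr] is vacuous for [n = 0]. *)
Definition vertex_stalk (n : nat) : lmodType R := if n is 0 then R^o else 'rV[R]_n.

Definition pr n (i : 'I_n) (c : 'rV[R]_n) : R^o := c 0 i.

Fact pr_linear n (i : 'I_n) : linear (pr i).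
Proof. by move=> k c d; rewrite /pr !mxE. Qed.

HB.instance Definition _ n (i : 'I_n) :=
  GRing.isLinear.Build R 'rV[R]_n R^o *:%R (pr i) (pr_linear i).

Definition wmean n (w : 'I_n -> R) (c : 'rV[R]_n) : R^o :=
  (\sum_j c 0 j * w j) / \sum_j w j.

Fact wmean_linear n (w : 'I_n -> R) : linear (wmean w).
Proof.
move=> k c d; rewrite /wmean -[k *: (_ / _)]/(k * (_ / _)) mulrA -mulrDl.
rewrite mulr_sumr -big_split; congr (_ / _).
by apply: eq_bigr => j _; rewrite !mxE mulrDl mulrA.
Qed.

HB.instance Definition _ n (w : 'I_n -> R) :=
  GRing.isLinear.Build R 'rV[R]_n R^o *:%R (wmean w) (wmean_linear w).

Definition incoming_restr (n : nat) : 'I_n -> {linear vertex_stalk n -> R^o} :=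
  match n with
  | 0 => fun=> idfun
  | n'.+1 => fun i => @pr n'.+1 i
  end.

Definition outgoing_restr (n : nat) :
    ('I_n -> R) -> {linear vertex_stalk n -> R^o} :=
  match n with
  | 0 => fun=> idfun
  | n'.+1 => fun w => @wmean n'.+1 w
  end.

End VertexRestrictions.

Section Concentration.
Variables (R : realType) (D : digraph) (r : flow_rate R D).

Definition cell_stalk (x : D + edge D) : lmodType R :=
  match x with
  | inl v => vertex_stalk R (in_degree v)
  | inr _ => R^o
  end.

(* By [incl_incident], only used for [e] incident to [v], hence outgoing from
   [v] when it is not incoming. *)
Definition incident_restr (v : D) (e : edge D) :
    {linear vertex_stalk R (in_degree v) -> R^o} :=
  match boolP (e \in in_edges v) with
  | AltTrue h => incoming_restr R (in_index h)
  | AltFalse _ => outgoing_restr (fun j : 'I_(in_degree v) => r (in_edge j))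
  end.

(* By [incl_incident], the zero map is never used. *)
Definition cell_restr (x y : D + edge D) : {linear cell_stalk x -> cell_stalk y} :=
  match x, y with
  | inl v, inr e => incident_restr v e
  | _, _ => \0
  end.

Fact concentration_restr_comp (a b c : face (graph_complex D))
    (ab : a ~> b) (bc : b ~> c) (ac : a ~> c) :
  cell_restr (cell_of b) (cell_of c) \o cell_restr (cell_of a) (cell_of b)
    =1 cell_restr (cell_of a) (cell_of c).
Proof. by case: (no_incl_chain ab bc). Qed.

Definition concentration : sheaf R (graph_complex D) :=
  @Sheaf R D (graph_complex D) (fun a => cell_stalk (cell_of a))
    (fun a b _ => cell_restr (cell_of a) (cell_of b)) concentration_restr_comp.

End Concentration.

Definition sampling (R : realType) (D : digraph) (r : flow_rate R D)
    (M : sheaf R (graph_complex D))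
    (m : sheaf_morphism (concentration r) M) : Prop :=
  forall e : face (graph_complex D), is_edge e ->
    (forall c, m e c = 0) /\ (forall y, exists c, m e c = y).

(* Main.v *)
Require Import Defs.
From mathcomp Require Import all_boot all_algebra reals.
Import GRing.Theory.
Local Open Scope ring_scope.

(** Taking global sections is left exact: for a morphism [m] from a sheaf [F] to
    a sheaf [G], the kernel of [induced m] is the
    space of global sections of the kernel sheaf of [m], which is the ambiguity
    sheaf.  Indeed a section of [F] killed by [m] takes its values in the
    kernels of the components of [m], and since the restrictions of the
    ambiguity sheaf are those of [F], the same family of values is a section of
    the ambiguity sheaf ([ambiguity_section]).  If the latter has only the zero
    section, then the linear map [induced m] has trivial kernel, hence is
    injective ([induced_inj]). *)

Section AmbiguitySections.
Set Implicit Arguments.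
Unset Strict Implicit.
Variables (R : realType) (A : Type) (X : simplicial_complex A).
Variables (F G : sheaf R X) (m : sheaf_morphism F G).

Section Lift.
Variables (s : global_section F) (ms0 : induced m s = 0).

Fact section_in_ker (a : face X) : s a \in ker (m a).
Proof.
rewrite inE; apply/eqP.
exact: (congr1 (fun t : global_section G => section_val t a) ms0).
Qed.

Fact ambiguity_section_compat :
  is_section (F := ambiguity m)
    (fun a => exist _ (s a) (section_in_ker a) : kernel (m a)).
Proof. by move=> a b ab; apply: val_inj; exact: section_compat. Qed.

Definition ambiguity_section : global_section (ambiguity m) :=
  GlobalSection ambiguity_section_compat.

End Lift.

Lemma induced_inj :
  (forall s : global_section (ambiguity m), s = 0) -> injective (induced m).
Proof.
move=> amb0; apply: raddf_inj => s ms0.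
apply: global_section_ext => a.
exact: (congr1 (fun t : global_section (ambiguity m) =>
  val (section_val t a : kernel (m a))) (amb0 (ambiguity_section ms0))).
Qed.

End AmbiguitySections.

Theorem theorem12 (R : realType) (X : digraph) (r : flow_rate R X)
    (M : sheaf R (graph_complex X))
    (m : sheaf_morphism (concentration r) M) (hm : sampling m) :
  (forall s : global_section (ambiguity m), s = 0) -> injective (induced m).
Proof. exact: induced_inj. Qed.
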